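(* There is no $\tau$-retentive tournament with exactly $4$ vertices. That is, there is no tournament $T$ having a minimal $\tau$-retentive set $R$ with $|R|=4$.
   Context: A tournament $T$ consists of a finite vertex set $V(T)$ and an asymmetric, complete binary relation $\succ$ on $V(T)$: for distinct $x,y$ exactly one of $x\succ y$, $y\succ x$ holds, and we say $x$ dominates $y$ if $x\succ y$. For $v\in V(T)$ let $N^-_T(v)=\{u\in V(T): u\succ v\}$. For $B\subseteq V(T)$, $T[B]$ is the subtournament induced by $B$. The tournament equilibrium set $\tau$ is defined recursively on the number of vertices: for a tournament $T$, a nonempty set $A\subseteq V(T)$ is $\tau$-retentive if for every $v\in A$ with $N^-_T(v)\neq\emptyset$ we have $\tau(T[N^-_T(v)])\subseteq A$; $A$ is a minimal $\tau$-retentive set if no $\tau$-retentive set of $T$ is a proper subset of $A$; and $\tau(T)$ is the union of all minimal $\tau$-retentive sets of $T$. A tournament $H$ is a $\tau$-retentive tournament if there is a tournament $T$ with a minimal $\tau$-retentive set $R$ such that $T[R]$ is isomorphic to $H$. *)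

(* Defs.v *)
From mathcomp Require Import all_boot.

Set Implicit Arguments.
Unset Strict Implicit.
Unset Printing Implicit Defensive.

(* Asymmetry includes irreflexivity. *)
Record tournament := Tournament {
  vertex :> finType;
  dominates : rel vertex;
  dominates_asym : forall x y, dominates x y -> ~~ dominates y x;
  dominates_total : forall x y, x != y -> dominates x y || dominates y x
}.

Section EquilibriumSet.

Variable T : tournament.
Implicit Types (A B : {set T}) (v : T).

(* Throughout, the induced subtournament T[B] is represented by its vertex set
   B : {set T}; T itself is [set: T]. *)
Definition dominators B v : {set T} := [set u in B | dominates u v].

(* A is a retentive set of T[B], relative to a candidate t for tau. *)
Definition retentive_for (t : {set T} -> {set T}) B A : bool :=
  [&& A != set0, A \subset B &
      [forall v in A, (dominators B v != set0) ==>
                      (t (dominators B v) \subset A)]].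

(* The recursion on the number of vertices is carried out with fuel n, which is
   sufficient as soon as #|B| <= n; tauE is the defining equation of tau. *)
Fixpoint tau_rec (n : nat) B : {set T} :=
  if n is m.+1
  then \bigcup_(A | minset (retentive_for (tau_rec m) B) A) A
  else set0.

Definition tau B : {set T} := tau_rec #|B| B.

Definition retentive B A : bool := retentive_for tau B A.

Definition minimal_retentive B A : bool := minset (retentive B) A.

Lemma card_dominators B v : v \in B -> #|dominators B v| < #|B|.
Proof.
move=> vB; apply: proper_card; apply/properP; split.
  by apply/subsetP => u; rewrite inE => /andP[].
exists v => //; rewrite inE vB /=; apply/negP => vv.
by have := dominates_asym vv; rewrite vv.
Qed.

Lemma eq_retentive_for t1 t2 B :
  {in B, forall v, t1 (dominators B v) = t2 (dominators B v)} ->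
  retentive_for t1 B =1 retentive_for t2 B.
Proof.
move=> t12 A; rewrite /retentive_for; case: (A != set0) => //=.
case sAB: (A \subset B) => //=; apply: eq_forallb_in => v vA.
by rewrite t12 // (subsetP sAB).
Qed.

Lemma tau_rec_fuel m n B : #|B| <= m -> #|B| <= n -> tau_rec m B = tau_rec n B.
Proof.
elim: m n B => [|m IHm] [|n] B //.
- rewrite leqn0 cards_eq0 => /eqP-> _ /=; rewrite big1 // => A.
  by case/minsetP => /and3P[_ +] _ _; rewrite subset0 => /eqP.
- move=> _; rewrite leqn0 cards_eq0 => /eqP-> /=; rewrite big1 // => A.
  by case/minsetP => /and3P[_ +] _ _; rewrite subset0 => /eqP.
move=> Bm Bn /=; apply: eq_bigl => A; apply: minset_eq.
apply: eq_retentive_for => v vB; have lt_v := card_dominators vB.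
by apply: IHm; rewrite -ltnS; apply: leq_trans lt_v _.
Qed.

Lemma tauE B : tau B = \bigcup_(A | minimal_retentive B A) A.
Proof.
rewrite /tau (@tau_rec_fuel _ #|B|.+1) //=.
apply: eq_bigl => A; apply: minset_eq; apply: eq_retentive_for => v vB.
by apply: tau_rec_fuel => //; rewrite ltnW // card_dominators.
Qed.

End EquilibriumSet.

(* f is an isomorphism from H onto T[R]. *)
Definition retentive_tournament (H : tournament) : Prop :=
  exists (T : tournament) (R : {set T}) (f : H -> T),
    [/\ minimal_retentive [set: T] R,
        injective f,
        f @: [set: H] = R &
        forall x y, dominates (f x) (f y) = dominates x y].

(* Main.v *)
(* In a minimal retentive set R with more than one vertex, every vertex is
   dominated from within R, so #|R| >= 3, and every u in R lies in
   tau (N^-(v)) for some v in R, since otherwise R :\ u would be retentive.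
   If #|R| = 4, then v itself dominates a vertex of R, so the minimal retentive
   set of N^-(v) containing u has at most two vertices and is therefore {u}.
   Thus u is undominated in N^-(v).  Choosing such a v for each u defines an
   injective successor map on R.  Applying it twice to u gives a vertex
   dominating u; on four vertices this leaves only a 3-cycle and a fixed point,
   or a 4-cycle, and both are contradictory. *)
Require Import Defs.
From mathcomp Require Import all_boot.

Set Implicit Arguments.
Unset Strict Implicit.
Unset Printing Implicit Defensive.

Section Retentive.

Variable T : tournament.
Implicit Types (A B M R : {set T}) (u v w x : T).

(** This says that [u] is the undominated vertex of the part of $N^-(v)$ lying in [R]. It is kept as
    a relation, so no successor function has to be chosen. *)
Definition successor R u v : Prop :=
  [/\ v \in R, dominates u v &
      forall x, x \in R -> dominates x v -> ~~ dominates x u].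

Lemma dominates_irrefl v : dominates v v = false.
Proof. by apply/negP => vv; have := dominates_asym vv; rewrite vv. Qed.

Lemma dominates_neq u v : dominates u v -> u != v.
Proof. by apply: contraTneq => ->; rewrite dominates_irrefl. Qed.

Lemma dominators_sub B v : dominators B v \subset B.
Proof. by apply/subsetP => u; rewrite inE => /andP[]. Qed.

Lemma tau_sub B : tau B \subset B.
Proof.
rewrite tauE; apply/bigcupsP => A /minsetP[/and3P[_ sAB _] _].
exact: sAB.
Qed.

Lemma retentive_self B : B != set0 -> retentive B B.
Proof.
move=> B0; apply/and3P; split => //; apply/forall_inP => v _.
by apply/implyP => _; apply: subset_trans (tau_sub _) (dominators_sub _ _).
Qed.

(** Since [B] is retentive in itself, it contains a minimal retentive set, which is nonempty and
    part of [tau B]. *)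
Lemma tau_neq0 B : B != set0 -> tau B != set0.
Proof.
move=> /retentive_self /minset_exists[M minM _].
have [/and3P[/set0Pn[x xM] _ _] _] := minsetP minM.
by apply/set0Pn; exists x; rewrite tauE; apply/bigcupP; exists M.
Qed.

Section MinimalRetentive.

Variables (B M : {set T}).
Hypothesis minM : minimal_retentive B M.

Lemma minimal_retentive_sub : M \subset B.
Proof. by case/minsetP: minM => /and3P[]. Qed.

Lemma minimal_retentive_tau v :
  v \in M -> dominators B v != set0 -> tau (dominators B v) \subset M.
Proof.
case/minsetP: minM => /and3P[_ _ /forall_inP retM] _ vM.
exact/implyP/retM.
Qed.

Lemma minimal_retentive_dominator v x :
  v \in M -> x \in B -> dominates x v -> exists2 u, u \in M & dominates u v.
Proof.
move=> vM xB xv; have domv : dominators B v != set0.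
  by apply/set0Pn; exists x; rewrite inE xB.
have /set0Pn[u ut] := tau_neq0 domv; exists u.
  exact: (subsetP (minimal_retentive_tau vM domv)).
by have := subsetP (tau_sub _) _ ut; rewrite inE => /andP[].
Qed.

(** A vertex undominated in [B] forms a retentive singleton, which by minimality would be all of
    [M]. *)
Lemma minimal_retentive_no_source v :
  v \in M -> M != [set v] -> exists2 u, u \in M & dominates u v.
Proof.
move=> vM; have [domv | /set0Pn[x]] := eqVneq (dominators B v) set0.
  have [_ /(_ [set v]) min] := minsetP minM.
  case/eqP; apply/esym/min; rewrite ?sub1set //; apply/and3P; split.
  - by apply/set0Pn; exists v; rewrite inE.
  - by rewrite sub1set (subsetP minimal_retentive_sub).
  - by apply/forall_inP => w /set1P->; rewrite domv eqxx.
rewrite inE => /andP[xB xv] _; exact: minimal_retentive_dominator xB xv.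
Qed.

(** Two backward steps inside [M] give [w], [u], [v], distinct by asymmetry. The ambient [B] is
    arbitrary because the bound is also needed inside $N^-(v)$. *)
Lemma minimal_retentive_card v : v \in M -> M != [set v] -> 2 < #|M|.
Proof.
move=> vM Mv; have [u uM uv] := minimal_retentive_no_source vM Mv.
have Mu : M != [set u].
  by apply: contraTneq vM => ->; rewrite inE eq_sym dominates_neq.
have [w wM wu] := minimal_retentive_no_source uM Mu.
have wv : w != v by apply: contraNneq (dominates_asym uv) => <-.
have <- : #|[set w; u; v]| = 3.
  by rewrite -setUA cardsU1 cards2 !inE negb_or wv (dominates_neq wu) (dominates_neq uv).
by apply: subset_leq_card; rewrite !subUset !sub1set wM uM.
Qed.

Lemma minimal_retentive_reached u :
  u \in M -> M != [set u] -> exists2 v, v \in M & u \in tau (dominators B v).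
Proof.
move=> uM Mu; apply/exists_inP; apply: contraT => /exists_inPn noreach.
have [_ /(_ (M :\ u)) min] := minsetP minM.
suff /min : retentive B (M :\ u).
  by rewrite subD1set => /(_ isT) /setP/(_ u); rewrite !inE eqxx uM.
apply/and3P; split.
- apply: contraNneq Mu => Mu0.
  by rewrite eqEsubset sub1set uM -setD_eq0 Mu0 eqxx.
- exact: subset_trans (subD1set _ _) minimal_retentive_sub.
- apply/forall_inP => v /setD1P[_ vM]; apply/implyP => domv.
  by rewrite subsetD1 minimal_retentive_tau ?noreach.
Qed.

End MinimalRetentive.

Lemma minimal_retentive4_successor B M u :
  minimal_retentive B M ->
  #|M| = 4 -> u \in M -> exists v, successor M u v.
Proof.
move=> minM M4; have nsing x : M != [set x].
  by apply: contra_eq_neq M4 => ->; rewrite cards1.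
move=> uM; have [v vM ut] := minimal_retentive_reached minM uM (nsing u).
have domuv := subsetP (tau_sub _) _ ut; exists v; split => //.
  by move: domuv; rewrite inE => /andP[].
have domv : dominators B v != set0 by apply/set0Pn; exists u.
have sub_tauM := minimal_retentive_tau minM vM domv.
move: ut; rewrite tauE => /bigcupP[M' minM' uM'].
have sM'M : M' \subset M.
  by apply: subset_trans sub_tauM; rewrite tauE bigcup_sup.
have sM'd : M' \subset dominators B v by case/minsetP: minM' => /and3P[].
(* The vertex [v] is reached in turn from some [w], which it dominates. Hence $N^-(v)$, and with it
   [M'], avoids both [v] and [w]. *)
have [w wM vt] := minimal_retentive_reached minM vM (nsing v).
have vw : dominates v w.
  by have := subsetP (tau_sub _) _ vt; rewrite inE => /andP[].
have M'2 : #|M'| <= 2.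
  have <- : #|(M :\ v) :\ w| = 2.
    (* Adding 2 on both sides turns the right-hand side into [#|M|], from which [v] and [w] are
       split off. *)
    apply/eqP; rewrite -(eqn_add2l 2) -[2 + 2]M4 (cardsD1 v M) vM.
    by rewrite (cardsD1 w (M :\ v)) !inE [w == v]eq_sym dominates_neq // wM.
  apply: subset_leq_card; rewrite !subsetD1 sM'M /=; apply/andP; split.
    by apply/negP => /(subsetP sM'd); rewrite inE dominates_irrefl andbF.
  apply/negP => /(subsetP sM'd); rewrite inE => /andP[_ wv].
  by move: (dominates_asym vw); rewrite wv.
have [M'u | M'u] := eqVneq M' [set u]; last first.
  by have := minimal_retentive_card minM' uM' M'u; rewrite ltnNge M'2.
(* Such an [x] would lie in $N^-(v)$, and retentiveness of [M'] would then give a dominator of [u]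
   within the singleton of [u]. *)
move=> x xM xv; apply/negP => xu.
have xdom : x \in dominators B v.
  by rewrite inE xv (subsetP (minimal_retentive_sub minM)).
have [u'] := minimal_retentive_dominator minM' uM' xdom xu.
by rewrite M'u inE => /eqP->; rewrite dominates_irrefl.
Qed.

Lemma no_successors4 R :
  #|R| = 4 -> ~ (forall u, u \in R -> exists v, successor R u v).
Proof.
move=> R4 ex_succ.
(* Two vertices with the same successor cannot dominate each other in either direction, so they
   coincide. *)
have succ_inj u u' v : u \in R -> u' \in R ->
  successor R u v -> successor R u' v -> u = u'.
  move=> uR u'R [_ uv srcu] [_ u'v srcu'].
  apply/eqP; apply: contraT => /dominates_total.
  by rewrite (negbTE (srcu _ u'R u'v)) (negbTE (srcu' _ uR uv)).
(* If [u] dominated [w], then [v] would not be undominated among the dominators of [w] in [R]. *)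
have succ_back u v w : u \in R ->
  successor R u v -> successor R v w -> dominates w u.
  move=> uR [_ uv _] [_ vw srcv].
  have wu : w != u by apply: contraNneq (dominates_asym vw) => ->.
  case/orP: (dominates_total wu) => // uw.
  by move: (srcv _ uR uw); rewrite uv.
have /card_gt0P[a aR] : 0 < #|R| by rewrite R4.
have [b ab] := ex_succ a aR; have [bR a_b _] := ab.
have [c bc] := ex_succ b bR; have [cR b_c _] := bc.
have c_a := succ_back _ _ _ aR ab bc.
have abc3 : #|[set a; b; c]| = 3.
  rewrite -setUA cardsU1 cards2 !inE negb_or.
  by rewrite (dominates_neq a_b) (dominates_neq b_c) eq_sym (dominates_neq c_a).
have sabc : [set a; b; c] \subset R by rewrite !subUset !sub1set aR bR.
have : #|R :\: [set a; b; c]| = 1.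
  by rewrite cardsD (setIidPr sabc) R4 abc3.
case/eqP/cards1P => d Rabc.
have : d \in R :\: [set a; b; c] by rewrite Rabc inE.
rewrite !inE !negb_or => /andP[/andP[/andP[da db] dc] dR].
have R_cases x : x \in R -> [\/ x = a, x = b, x = c | x = d].
  move=> xR; have /setP/(_ x) := Rabc; rewrite !inE xR andbT.
  have [->|_] := eqVneq x a; first by constructor 1.
  have [->|_] := eqVneq x b; first by constructor 2.
  have [->|_] := eqVneq x c; first by constructor 3.
  by move=> /esym /eqP ->; constructor 4.
have [e ce] := ex_succ c cR; have [eR c_e _] := ce.
(* The values [b] and [c] are already taken as successors, so injectivity leaves only [a] for the
   successor of [d]. *)
have [f df] := ex_succ d dR; have [fR d_f srcd] := df.
have neq_b : f <> b.
  by move=> fb; case/eqP: da; apply: succ_inj df _ => //; rewrite fb.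
have neq_c : f <> c.
  by move=> fc; case/eqP: db; apply: succ_inj df _ => //; rewrite fc.
have neq_d : f <> d by move=> fd; move: d_f; rewrite fd dominates_irrefl.
have fa : f = a by case: (R_cases f fR).
(* As [c] dominates [a], it cannot dominate [d], which is undominated among the dominators of [a] in
   [R]. No successor is then left for [c]. *)
have c_d : ~~ dominates c d by apply: srcd; rewrite ?fa.
case: (R_cases e eR) => eE; subst e.
- by case/eqP: dc; apply: succ_inj df _ => //; rewrite fa.
- by have := dominates_asym c_e; rewrite b_c.
- by move: c_e; rewrite dominates_irrefl.
- by rewrite c_e in c_d.
Qed.

End Retentive.

Theorem theorem1 : ~ exists H : tournament, retentive_tournament H /\ #|H| = 4.
Proof.
case=> H [[T [R [f [minR injf fR _]]]] H4].
have R4 : #|R| = 4 by rewrite -fR card_imset // cardsT.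
apply: (no_successors4 R4) => u; exact: minimal_retentive4_successor minR R4.
Qed.
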